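(* Let $G$ be a finite nilpotent group with identity $e$. Then $\mathrm{Dom}(\mathcal{G}_E(G))=\{e\}$ if and only if no Sylow subgroup of $G$ is either cyclic or generalized quaternion.
   Context: For a group $G$, the enhanced power graph $\mathcal{G}_E(G)$ is the simple graph with vertex set $G$ in which two distinct elements $x,y$ are adjacent if and only if there is $w\in G$ with $x\in\langle w\rangle$ and $y\in\langle w\rangle$. A dominating vertex of a graph $\Gamma$ is a vertex adjacent to every other vertex; $\mathrm{Dom}(\Gamma)$ is the set of all dominating vertices of $\Gamma$. ''Sylow subgroups of $G$'' means Sylow $p$-subgroups for the primes $p$ dividing $|G|$. *)

(* Defs.v *)
From mathcomp Require Import all_boot all_fingroup all_solvable.

Set Implicit Arguments.
Unset Strict Implicit.
Unset Printing Implicit Defensive.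

Local Open Scope group_scope.

(* A simple graph is given by its vertex set V : {set T} together with an
   irreflexive symmetric adjacency relation on T; here V is the group G. *)
Definition enhanced_power_graph (gT : finGroupType) (G : {group gT}) : rel gT :=
  [rel x y | [&& x \in G, y \in G, x != y &
              [exists w in G, (x \in <[w]>) && (y \in <[w]>)]]].

Definition Dom (T : finType) (V : {set T}) (e : rel T) : {set T} :=
  [set x in V | [forall y in V, (y != x) ==> e x y]].

Definition generalized_quaternion (gT : finGroupType) (P : {group gT}) : Prop :=
  exists2 n, n > 2 & P \isog 'Q_(2 ^ n).

Lemma enhanced_power_graph_irr (gT : finGroupType) (G : {group gT}) :
  irreflexive (enhanced_power_graph G).
Proof. by move=> x; rewrite /enhanced_power_graph /= eqxx !andbF. Qed.

Lemma enhanced_power_graph_sym (gT : finGroupType) (G : {group gT}) :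
  symmetric (enhanced_power_graph G).
Proof.
move=> x y; rewrite /enhanced_power_graph /= andbCA [y == x]eq_sym; do 3!congr (_ && _).
by apply: eq_existsb => w; rewrite [(y \in _) && _]andbC.
Qed.

(* Main.v *)
Require Import Defs.
From mathcomp Require Import all_boot all_fingroup all_solvable.

(** A nontrivial p-group is cyclic or generalized quaternion exactly when it has a unique
    subgroup of order p ([cyclic_or_quaternionP], a consequence of the
    classification [prime_Ohm1P] of the p-groups P with 'Ohm_1(P) of order p).
    So the theorem amounts to: 1 is the only dominating vertex of G iff no
    Sylow subgroup of G has a unique subgroup of prime order.

    If x <> 1 is dominating, so is any power z of x of prime order p
    ([Dom_cycle]).  Each y of order p shares a cyclic group with z, and a cyclic
    group has at most one subgroup of order p, so <[y]> = <[z]>.  Hence <[z]> is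
    the unique subgroup of order p in any Sylow p-subgroup that contains z.

    Conversely, let <[z]> be the unique subgroup of order p in the Sylow
    p-subgroup P.  As G is nilpotent, P contains all p-elements of G, so <[z]> is
    also the unique subgroup of order p in G, and every y of order divisible by p
    has z among its powers.  If p does not divide #[y], then y commutes with z
    and has order coprime to that of z, so both are powers of z * y.  Either way
    z and y lie in a common cyclic group, so z is dominating
    ([unique_order_p_Dom]). *)

Local Open Scope group_scope.

Section Domination.

Set Implicit Arguments.
Unset Strict Implicit.

Variables (gT : finGroupType) (G : {group gT}).
Implicit Types (p : nat) (x y z : gT) (P : {group gT}).

(** The vertex y = x can be included in the quantification, since x lies in the
    cyclic group that it generates. *)
Lemma DomP x :
  reflect (x \in G /\
           forall y, y \in G -> exists2 w, w \in G & x \in <[w]> /\ y \in <[w]>)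
          (x \in Dom G (enhanced_power_graph G)).
Proof.
rewrite !inE; apply: (iffP andP) => [] [Gx domx]; split=> //.
  move=> y Gy; have [-> | neq_yx] := eqVneq y x.
    by exists x; rewrite ?cycle_id.
  move/forall_inP/(_ y Gy): domx; rewrite neq_yx /= => /and4P[_ _ _].
  by case/existsP=> w /and3P[Gw xw yw]; exists w.
apply/forall_inP=> y Gy; apply/implyP=> neq_yx.
have [w Gw [xw yw]] := domx y Gy.
rewrite /enhanced_power_graph /= Gx Gy eq_sym neq_yx.
by apply/existsP; exists w; rewrite Gw xw.
Qed.

Lemma Dom1 : 1 \in Dom G (enhanced_power_graph G).
Proof. by apply/DomP; split=> // y Gy; exists y; rewrite ?cycle_id ?group1. Qed.

Lemma Dom_cycle x z :
    x \in Dom G (enhanced_power_graph G) -> z \in <[x]> ->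
  z \in Dom G (enhanced_power_graph G).
Proof.
case/DomP=> Gx domx xz; apply/DomP; split=> [|y Gy].
  by apply: subsetP xz; rewrite cycle_subG.
have [w Gw [xw yw]] := domx y Gy; exists w => //; split=> //.
by apply: subsetP xz; rewrite cycle_subG.
Qed.

Lemma Dom_order_cycle z y :
    z \in Dom G (enhanced_power_graph G) -> y \in G -> #[y] = #[z] ->
  <[y]> = <[z]>.
Proof.
case/DomP=> _ domz Gy oyz; have [w _ [zw yw]] := domz y Gy.
apply/eqP; rewrite (eq_subG_cyclic (cycle_cyclic w)) ?cycle_subG //.
exact/eqP.
Qed.

Lemma mem_Ohm1_order p P x :
  p.-group P -> x \in P -> #[x] = p -> x \in 'Ohm_1(P).
Proof.
move=> pP Px ox; rewrite (OhmE 1 pP) mem_gen // !inE Px expn1.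
by rewrite -ox expg_order eqxx.
Qed.

(** This is [prime_Ohm1P] without p = 2 in the quaternion alternative: the
    order of a generalized quaternion group is a power of 2, so it forces p = 2. *)
Lemma cyclic_or_quaternionP p P :
    p.-group P -> P :!=: 1 ->
  #|'Ohm_1(P)| = p <-> cyclic P \/ generalized_quaternion P.
Proof.
move=> pP ntP; split=> [/(prime_Ohm1P pP ntP)/orP[-> |] | cqP]; first by left.
  by case/andP=> _ /eqP/quaternion_classP; right.
apply/(prime_Ohm1P pP ntP); case: cqP => [-> // | qP]; apply/orP; right.
move/quaternion_classP: (qP) => ->; rewrite andbT.
have [n n_gt2 isoP] := qP; have [p_pr p_dv _] := pgroup_pdiv pP ntP.
move: p_dv; rewrite (card_isog isoP) card_quaternion //.
by rewrite Euclid_dvdX // dvdn_prime2 // => /andP[].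
Qed.

Lemma Dom_prime_order_Sylow p P z :
    z \in Dom G (enhanced_power_graph G) -> prime p -> #[z] = p ->
    p.-Sylow(G) P -> z \in P ->
  #|'Ohm_1(P)| = p.
Proof.
move=> domz p_pr oz sylP Pz; have pP := pHall_pgroup sylP.
rewrite -[RHS]oz orderE; suffices -> : 'Ohm_1(P) = <[z]> by [].
apply/eqP; rewrite eqEsubset cycle_subG (mem_Ohm1_order pP) // andbT.
rewrite (OhmE 1 pP) gen_subG expn1; apply/subsetP=> y /LdivP[Py yp1].
have [-> | nty] := eqVneq y 1; first exact: group1.
have oy : #[y] = #[z] by rewrite oz (nt_prime_order p_pr yp1 nty).
by rewrite /= -(Dom_order_cycle domz _ oy) ?cycle_id // (subsetP (pHall_sub sylP)).
Qed.

Lemma unique_order_p_Dom p P z :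
    nilpotent G -> prime p -> p.-Sylow(G) P -> #|'Ohm_1(P)| = p ->
    z \in P -> #[z] = p ->
  z \in Dom G (enhanced_power_graph G).
Proof.
move=> nilG p_pr sylP oP1 Pz oz; have pP := pHall_pgroup sylP.
have Gz : z \in G := subsetP (pHall_sub sylP) z Pz.
have genP1 u : u \in P -> #[u] = p -> <[u]> = 'Ohm_1(P).
  move=> Pu ou; apply/eqP; rewrite eqEcard cycle_subG (mem_Ohm1_order pP) //=.
  by rewrite -orderE ou oP1.
apply/DomP; split=> // y Gy; have [p_dv_y | p'y] := boolP (p %| #[y]).
  have [u yu ou] := Cauchy p_pr p_dv_y.
  have Gu : u \in G by apply: subsetP yu; rewrite cycle_subG.
  (* Nilpotency: P is normal in G, so it contains every p-element of G. *)
  have Pu : u \in P.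
    rewrite (nilpotent_Hall_pcore nilG sylP).
    rewrite (mem_normal_Hall (nilpotent_pcore_Hall p nilG)) ?pcore_normal //.
    by rewrite /p_elt ou pnat_id.
  exists y; rewrite ?cycle_id //; split=> //.
  have : z \in <[u]> by rewrite (genP1 u) // -(genP1 z) // cycle_id.
  by apply: subsetP; rewrite cycle_subG.
have co_zy : coprime #[z] #[y] by rewrite oz prime_coprime.
have czy : commute z y.
  apply: (centsP (_ : <[z]> \subset 'C(<[y]>))); rewrite ?cycle_id //.
  by apply: (sub_nilpotent_cent2 nilG); rewrite ?cycle_subG // coprime_sym.
exists (z * y); first exact: groupM.
rewrite cycleM //; split.
  by apply: (subsetP (mulG_subl _ _)); exact: cycle_id.
by apply: (subsetP (mulG_subr _ _)); exact: cycle_id.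
Qed.

End Domination.

Theorem theorem2p1 (gT : finGroupType) (G : {group gT}) (nilG : nilpotent G) :
  Dom G (enhanced_power_graph G) = [set 1] <->
  (forall (p : nat) (P : {group gT}), p \in \pi(G) -> p.-Sylow(G) P ->
     ~ (cyclic P \/ generalized_quaternion P)).
Proof.
have ntSyl p (P : {group gT}) : p \in \pi(G) -> p.-Sylow(G) P -> P :!=: 1.
  by move=> piGp sylP; rewrite -rank_gt0 (rank_Sylow sylP) p_rank_gt0.
split=> [domG1 p P piGp sylP cqP | noCQ].
  have pP := pHall_pgroup sylP; have ntP := ntSyl p P piGp sylP.
  have [p_pr p_dv _] := pgroup_pdiv pP ntP.
  have [z Pz oz] := Cauchy p_pr p_dv.
  have oP1 := (cyclic_or_quaternionP pP ntP).2 cqP.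
  have := unique_order_p_Dom nilG p_pr sylP oP1 Pz oz.
  by rewrite domG1 inE -order_eq1 oz => /eqP p1; rewrite p1 in p_pr.
apply/setP=> x; rewrite in_set1; apply/idP/eqP=> [domx | ->]; last exact: Dom1.
apply/eqP; apply: contraT; rewrite -order_eq1 => ntx.
have p_pr : prime (pdiv #[x]).
  by rewrite pdiv_prime // ltn_neqAle eq_sym ntx order_gt0.
have [z xz oz] := Cauchy p_pr (pdiv_dvd #[x]).
have domz := Dom_cycle domx xz; have [Gz _] := DomP _ _ domz.
have p_z : (pdiv #[x]).-group <[z]> by rewrite /pgroup -orderE oz pnat_id.
have [|P sylP] := Sylow_superset _ p_z (G := G); first by rewrite cycle_subG.
rewrite cycle_subG => Pz; have pP := pHall_pgroup sylP.
have piGp : pdiv #[x] \in \pi(G).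
  by rewrite mem_primes p_pr cardG_gt0 -{1}oz order_dvdG.
case: (noCQ _ P piGp sylP).
apply/(cyclic_or_quaternionP pP (ntSyl _ P piGp sylP)).
exact: Dom_prime_order_Sylow domz p_pr oz sylP Pz.
Qed.
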